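(* Let $T\in\mathcal{L}(\mathcal{H})$ have closed range and let $p$ be a complex polynomial in one variable such that $p(0)=0$. The following statements are equivalent: (i) $T$ is $p$-hypo-EP; (ii) $p(T)=T^\dagger T\,p(T)$; (iii) $R(p(T))\subset R(T^* )$; (iv) $T^\dagger T\,p(T)\,T^\dagger=p(T)\,T^\dagger$; (v) $T^\dagger T\,p(T)+(T^\dagger T\,p(T))^*=p(T)+p(T)^*$.
   Context: $\mathcal{H}$ is a complex Hilbert space, $\mathcal{L}(\mathcal{H})$ is the algebra of bounded linear operators on $\mathcal{H}$, and $R(\cdot)$ denotes range. For $T\in\mathcal{L}(\mathcal{H})$ with closed range, the Moore-Penrose inverse $T^\dagger$ is the unique operator with $TT^\dagger T=T$, $T^\dagger TT^\dagger=T^\dagger$, $(T^\dagger T)^*=T^\dagger T$, $(TT^\dagger)^*=TT^\dagger$. For a complex polynomial $p$ (the notion is introduced for nontrivial $p$), a closed range operator $T$ is $p$-hypo-EP ($p$-HEP) if $T^\dagger T\,p(T)=p(T)\,T^\dagger T$. *)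

(* Defs.v *)
From HB Require Import structures.
From mathcomp Require Import all_boot all_order all_algebra.
From mathcomp Require Import complex.
From mathcomp Require Import all_classical all_reals all_analysis.

Set Implicit Arguments.
Unset Strict Implicit.
Unset Printing Implicit Defensive.

Import Order.TTheory GRing.Theory Num.Theory.
Import numFieldNormedType.Exports.

Local Open Scope classical_set_scope.
Local Open Scope ring_scope.
Local Open Scope complex_scope.

(* A complex Hilbert space is a complete normed R[i]-module H together with a
   dot product, linear in its first argument and conjugate-linear in the
   second, that induces the norm. Operators are functions H -> H, so sums and
   scalings of operators are the pointwise ones and products are \o. *)
Definition induces_norm (R : realType) (H : completeNormedModType R[i])
    (dot : {dot H for Num.conj}) : Prop :=
  forall x : H, `|x| ^+ 2 = dot x x.

Definition bounded_operator (R : realType) (H : completeNormedModType R[i])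
    (T : H -> H) : Prop :=
  linear T /\ exists M : R[i], forall x : H, `|T x| <= M * `|x|.

(* Every bounded operator has exactly one bounded adjoint, so get picks it;
   its value on other functions is unspecified. *)
Definition adjoint (R : realType) (H : completeNormedModType R[i])
    (dot : {dot H for Num.conj}) (T : H -> H) : H -> H :=
  get [set S : H -> H | bounded_operator S /\
    forall x y : H, dot (T x) y = dot x (S y)].

(* Exactly one operator satisfies the condition when T is a bounded operator
   with closed range; the value is unspecified when there is none. *)
Definition moore_penrose (R : realType) (H : completeNormedModType R[i])
    (dot : {dot H for Num.conj}) (T : H -> H) : H -> H :=
  get [set S : H -> H | bounded_operator S /\
    [/\ T \o S \o T = T,
        S \o T \o S = S,
        adjoint dot (S \o T) = S \o T
      & adjoint dot (T \o S) = T \o S]].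

Definition poly_operator (R : realType) (H : completeNormedModType R[i])
    (p : {poly R[i]}) (T : H -> H) : H -> H :=
  \sum_(i < size p) p`_i *: iter i T.

Definition hypo_EP (R : realType) (H : completeNormedModType R[i])
    (dot : {dot H for Num.conj}) (p : {poly R[i]}) (T : H -> H) : Prop :=
  closed (range T) /\
  moore_penrose dot T \o T \o poly_operator p T =
    poly_operator p T \o moore_penrose dot T \o T.

(* Main.v *)
Require Import Defs.
From HB Require Import structures.
From mathcomp Require Import all_boot all_order all_algebra.
From mathcomp Require Import complex.
From mathcomp Require Import all_classical all_reals all_analysis.
From mathcomp Require Import ring lra.

Set Implicit Arguments.
Unset Strict Implicit.
Unset Printing Implicit Defensive.

Import Order.TTheory GRing.Theory Num.Theory.
Import numFieldNormedType.Exports.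

Local Open Scope classical_set_scope.
Local Open Scope ring_scope.
Local Open Scope complex_scope.

(** Write [T'] for the adjoint of [T] and [P] for [Td \o T].  The defining
equations of the Moore-Penrose inverse make [P] a self-adjoint idempotent with
[T \o P = T], and its range is the range of [T'].  Since [p] has no constant
term, every monomial of [p(T)] ends with a factor [T], so [p(T) P = p(T)]
always holds ([poly_operator_fixed]).  Hence commutation of [P] with [p(T)]
says exactly [P p(T) = p(T)], which says that [P] fixes the range of [p(T)],
that is, [R(p(T))] lies in [R(T')] ([moore_penrose_adjoint_range]).  Composing
the fourth statement with [T] on the right gives back [P p(T) = p(T)].  In the
last statement, [D = p(T) - P p(T)] is skew-adjoint with [D D = 0], because
[D = D P] and [P D = 0]; so [<D x, D x> = - <x, D D x> = 0] and [D = 0].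

The operators in this argument are chosen by [get], so the substance is that
the adjoint and the Moore-Penrose inverse exist.  Two facts about a closed
subspace [V] give both.

- [symmetric_lax_milgram]: a bounded functional on [V] is represented by any
  bounded symmetric coercive form on [V].  With the inner product this is the
  Riesz theorem, hence the adjoint.
- [weakly_bounded]: a subset of [V] that is bounded against each vector of [V]
  is bounded in norm.  Applied to the [w] in [R(T)] with [|T' w| <= 1], which
  satisfy [|<T x, w>| <= |x|], it shows that [T'] is bounded below on [R(T)].

So [<T' u, T' v>] is coercive on [R(T)], and for each [y] there is [w] in
[R(T)] with [<T' v, T' w> = <v, y>] for all [v] in [R(T)], i.e. [T T' w] is the
orthogonal projection of [y] on [R(T)].  The Moore-Penrose inverse is
[y |-> T' w].

Both facts concern norms and real parts only, so they are proved for the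
real-valued norm [rnorm] and the real inner product [rdot]. *)

(** * Elementary facts on ordered fields *)

(** Both Cauchy-Schwarz and the approximate first-order condition of a
quadratic minimization problem are instances. *)
Lemma discriminant_le (R : realFieldType) (a b c : R) :
  0 <= a -> 0 <= c -> (forall t, 0 <= a + 2 * t * b + t ^+ 2 * c) ->
  b ^+ 2 <= a * c.
Proof.
move=> a0; rewrite le_eqVlt => /predU1P[<-|c0] h.
  rewrite mulr0; have [->|b0] := eqVneq b 0; first by rewrite expr0n.
  have := h (- (a + 1) / (2 * b)).
  have -> : a + 2 * (- (a + 1) / (2 * b)) * b + (- (a + 1) / (2 * b)) ^+ 2 * 0
      = -1 by field.
  lra.
have := h (- b / c).
have -> : a + 2 * (- b / c) * b + (- b / c) ^+ 2 * c = a - b ^+ 2 / c.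
  by field; rewrite gt_eqF.
by rewrite subr_ge0 ler_pdivrMr.
Qed.

Lemma eq0_if_le_multiples (R : realFieldType) (a b : R) :
  0 <= a -> 0 <= b -> (forall e, 0 < e -> a <= e * b) -> a = 0.
Proof.
move=> a0 b0 h; apply/eqP; rewrite eq_le a0 andbT; apply/ler_addgt0Pr => e e0.
rewrite add0r; have b1 : 0 < b + 1 by lra.
apply: (le_trans (h (e / (b + 1)) (divr_gt0 e0 b1))).
by rewrite mulrAC ler_pdivrMr// ler_pM2l//; lra.
Qed.

(** * The underlying real inner product space *)

Section RealPart.
Context (R : realType) (H : completeNormedModType R[i]).
Context (dot : {dot H for Num.conj}) (hdot : induces_norm dot).

Definition rnorm (x : H) : R := complex.Re `|x|.
Definition rdot (x y : H) : R := complex.Re (dot x y).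

Lemma rnormE x : `|x| = (rnorm x)%:C.
Proof. by rewrite /rnorm RRe_real ?normr_real. Qed.

Lemma rnorm_ge0 x : 0 <= rnorm x.
Proof. by rewrite -ler0c -rnormE normr_ge0. Qed.

Lemma rnorm0 : rnorm 0 = 0.
Proof. by rewrite /rnorm normr0. Qed.

Lemma rnorm_eq0 x : (rnorm x == 0) = (x == 0).
Proof. by rewrite -(inj_eq (@complexI R)) -rnormE normr_eq0. Qed.

Lemma ler_rnormD x y : rnorm (x + y) <= rnorm x + rnorm y.
Proof. by rewrite -lecR rmorphD /= -!rnormE ler_normD. Qed.

Lemma rnormN x : rnorm (- x) = rnorm x.
Proof. by rewrite /rnorm normrN. Qed.

Lemma rnorm_distC x y : rnorm (x - y) = rnorm (y - x).
Proof. by rewrite -rnormN opprB. Qed.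

Lemma rnormZr (a : R) x : rnorm (a%:C *: x) = `|a| * rnorm x.
Proof.
apply: (@complexI R); rewrite rmorphM /= -!rnormE normrZ; congr (_ * _).
by rewrite normc_def /= expr0n addr0 sqrtr_sqr.
Qed.

Lemma dotxx x : dot x x = (rnorm x ^+ 2)%:C.
Proof. by rewrite -hdot rnormE rmorphXn. Qed.

Lemma rnorm_sqr x : rnorm x ^+ 2 = rdot x x.
Proof. by rewrite /rdot dotxx. Qed.

Lemma dotC x y : dot x y = (dot y x)^*.
Proof. by rewrite hermC /= expr0 mul1r. Qed.

Lemma rdotC x y : rdot x y = rdot y x.
Proof. by rewrite /rdot dotC; case: (dot y x). Qed.

Lemma rdotPl (a : R) x y z : rdot (a%:C *: x + y) z = a * rdot x z + rdot y z.
Proof.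
rewrite /rdot linearPl /=; case: (dot x z) => p q; case: (dot y z) => r s /=.
by rewrite mul0r subr0.
Qed.

Lemma rdotDl x y z : rdot (x + y) z = rdot x z + rdot y z.
Proof. by rewrite -[x]scale1r (rdotPl 1) mul1r scale1r. Qed.

Lemma rdotZl (a : R) x z : rdot (a%:C *: x) z = a * rdot x z.
Proof. by rewrite -[_ *: x]addr0 rdotPl /rdot linear0l /= addr0. Qed.

Lemma rdotNl x z : rdot (- x) z = - rdot x z.
Proof. by rewrite /rdot linearNl raddfN. Qed.

Lemma rdotBl x y z : rdot (x - y) z = rdot x z - rdot y z.
Proof. by rewrite rdotDl rdotNl. Qed.

Lemma rdot_le x y : `|rdot x y| <= rnorm x * rnorm y.
Proof.
rewrite -ler_sqr ?nnegrE ?mulr_ge0 ?rnorm_ge0// real_normK ?num_real//.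
rewrite exprMn; apply: discriminant_le; rewrite ?sqr_ge0// => t.
have := sqr_ge0 (rnorm (t%:C *: y + x)).
rewrite [X in 0 <= X -> _]rnorm_sqr rdotPl (rdotC y) (rdotC x) !rdotPl.
by rewrite -!rnorm_sqr (rdotC y x) => h; apply: le_trans h _; lra.
Qed.

Lemma dotxx_eq0 x : dot x x = 0 -> x = 0.
Proof. by move=> /eqP; rewrite dnorm_eq0 => /eqP. Qed.

Lemma dot_inj x y : (forall z, dot z x = dot z y) -> x = y.
Proof.
move=> h; apply/eqP; rewrite -subr_eq0; apply/eqP/dotxx_eq0.
by rewrite linearBr /= h subrr.
Qed.

Definition is_subspace (V : set H) : Prop :=
  V 0 /\ forall (a : R[i]) x y, V x -> V y -> V (a *: x + y).

Lemma subspaceD V x y : is_subspace V -> V x -> V y -> V (x + y).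
Proof. by move=> [_ h] Vx Vy; rewrite -[x]scale1r; exact: h. Qed.

Lemma subspaceZ V a x : is_subspace V -> V x -> V (a *: x).
Proof. by move=> [V0 h] Vx; rewrite -[_ *: _]addr0; exact: h. Qed.

Lemma subspaceB V x y : is_subspace V -> V x -> V y -> V (x - y).
Proof.
by move=> sV Vx Vy; apply: subspaceD => //; rewrite -scaleN1r; exact: subspaceZ.
Qed.

(** The scalars of the norm of [H] are complex, hence only partially ordered;
this restates completeness with real tolerances. *)
Lemma cauchy_converges (V : set H) (u : nat -> H) : closed V ->
  (forall n, V (u n)) ->
  (forall e : R, 0 < e -> exists N, forall m n, (N <= m)%N -> (N <= n)%N ->
     rnorm (u m - u n) < e) ->
  exists2 x, V x & forall e : R, 0 < e -> exists N, forall n, (N <= n)%N ->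
     rnorm (x - u n) < e.
Proof.
move=> clV Vu Cu.
(* A positive element of R[i] is real. *)
have ltN (e : R[i]) (e0 : 0 < e) : 0 < complex.Re e /\ e = (complex.Re e)%:C.
  move: e0; rewrite ltcE /= => /andP[/eqP ie re]; split=> //.
  by rewrite [LHS]complexE ie rmorph0 mulr0 addr0.
have cvu : cvg (u @ \oo).
  apply: cauchy_cvg; apply: cauchy_exP => e /ltN[e0 ->].
  have [N hN] := Cu _ e0; exists (u N), N => // n /= Nn.
  by rewrite -ball_normE /ball_ /= rnormE ltcR hN.
exists (lim (u @ \oo)).
  by apply: closed_cvg cvu => //; exact: nearW.
move=> e e0; move/cvgrPdist_lt : cvu => /(_ e%:C).
rewrite ltcR => /(_ e0)[N _ hN]; exists N => n Nn.
by rewrite -ltcR -rnormE; exact: hN n Nn.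
Qed.

End RealPart.

(** * Representation and uniform boundedness on closed subspaces *)

Section Existence.
Context (R : realType) (H : completeNormedModType R[i]).
Context (dot : {dot H for Num.conj}) (hdot : induces_norm dot).
Local Notation rdot := (rdot dot).

(** The representing vector minimizes [q v = b v v - 2 phi v] on [V].
Coercivity bounds [q] from below, and the parallelogram identity for [b] makes
every minimizing sequence Cauchy.  Instead of showing that [q] attains its
infimum at the limit, the first-order condition is derived along the sequence:
if [u] is within [e ^+ 2] of the infimum, then [q (u + t v) >= q u - e ^+ 2]
for all [t] bounds [b u v - phi v] by [e * sqrt (b v v)], and this passes to
the limit. *)
Lemma symmetric_lax_milgram (V : set H) (b : H -> H -> R) (phi : H -> R)
    (c M C : R) :
  closed V -> is_subspace V ->
  (forall (a : R) x y z, b (a%:C *: x + y) z = a * b x z + b y z) ->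
  (forall x y, b x y = b y x) ->
  0 < c -> (forall v, V v -> c * rnorm v ^+ 2 <= b v v) ->
  (forall u v, `|b u v| <= M * (rnorm u * rnorm v)) ->
  (forall (a : R) x y, phi (a%:C *: x + y) = a * phi x + phi y) ->
  (forall v, `|phi v| <= C * rnorm v) ->
  exists2 x, V x & forall v, V v -> b x v = phi v.
Proof.
move=> clV sV bl bC c0 coer bM phil phiC.
have br a x y z : b z (a%:C *: x + y) = a * b z x + b z y.
  by rewrite bC bl !(bC z).
have b_ge0 v : V v -> 0 <= b v v.
  by move=> Vv; apply: le_trans (coer v Vv); rewrite mulr_ge0 ?sqr_ge0 ?ltW.
pose q v := b v v - 2 * phi v.
pose m := inf [set q v | v in V].
have infV : has_inf [set q v | v in V].
  split; first by exists (q 0), 0 => //; case: sV.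
  (* The lower bound comes from completing the square. *)
  exists (- (C ^+ 2 / c)) => _ [v Vv <-]; rewrite /q.
  have h1 := coer v Vv; have := phiC v; rewrite ler_norml => /andP[_ h2].
  have h3 : 0 <= (c * rnorm v - C) ^+ 2 / c by rewrite divr_ge0 ?sqr_ge0 ?ltW.
  have h4 : (c * rnorm v - C) ^+ 2 / c =
      c * rnorm v ^+ 2 - 2 * (C * rnorm v) + C ^+ 2 / c.
    by field; rewrite gt_eqF.
  lra.
have m_le v : V v -> m <= q v.
  by move=> Vv; apply: ge_inf; [case: infV|exists v].
have eps_gt0 n : 0 < n.+1%:R^-1 :> R by rewrite invr_gt0.
have /choice[u hu] : forall n, exists v, V v /\ q v < m + n.+1%:R^-1.
  move=> n; have [_ [v Vv <-] qv] := inf_adherent (eps_gt0 n) infV.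
  by exists v.
have parallelogram v w : V v -> V w ->
    c * rnorm (v - w) ^+ 2 <= 2 * (q v - m) + 2 * (q w - m).
  move=> Vv Vw; apply: (le_trans (coer _ (subspaceB sV Vv Vw))).
  have := m_le _ (subspaceZ (2^-1 : R)%:C sV (subspaceD sV Vv Vw)).
  rewrite /q -[_ *: (v + w)]addr0.
  have b0l z : b 0 z = 0.
    by have := bl 1 0 0 z; rewrite scaler0 addr0; lra.
  have p0 : phi 0 = 0 by have := phil 1 0 0; rewrite scaler0 addr0; lra.
  have -> : v - w = (-1 : R)%:C *: w + v by rewrite rmorphN scaleN1r addrC.
  have -> : v + w = (1 : R)%:C *: v + w by rewrite scale1r.
  rewrite !(bl, br) (bC v 0) (bC w 0) !b0l phil p0 phil (bC w v).
  lra.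
have small (e : R) : 0 < e -> exists N, forall n, (N <= n)%N -> n.+1%:R^-1 < e.
  move=> e0; exists (Num.truncn e^-1) => n Nn.
  rewrite invf_plt ?posrE// (lt_le_trans (truncnS_gt _))// ler_nat ltnS //.
have Cu (e : R) : 0 < e -> exists N, forall i j, (N <= i)%N -> (N <= j)%N ->
    rnorm (u i - u j) < e.
  move=> e0; have ce0 : 0 < c * e ^+ 2 / 4.
    by rewrite !mulr_gt0 ?exprn_gt0 ?invr_gt0.
  have [N hN] := small _ ce0; exists N => i j Ni Nj.
  rewrite -ltr_sqr ?nnegrE ?rnorm_ge0 1?ltW// -(ltr_pM2l c0).
  have [Vi qi] := hu i; have [Vj qj] := hu j.
  have := parallelogram _ _ Vi Vj; have := hN _ Ni; have := hN _ Nj.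
  move: (i.+1%:R^-1) (j.+1%:R^-1) qi qj => di dj; lra.
have [x Vx ux] := cauchy_converges clV (fun n => (hu n).1) Cu.
exists x => // v Vv; apply/eqP; rewrite -subr_eq0 -normr_eq0; apply/eqP.
apply: (@eq0_if_le_multiples _ _ (`|M| * rnorm v + Num.sqrt (b v v))) => //.
  by rewrite addr_ge0 ?mulr_ge0 ?rnorm_ge0 ?sqrtr_ge0.
move=> e e0; have [N1 hN1] := ux _ e0.
have [N2 hN2] := small _ (exprn_gt0 2 e0).
pose n := maxn N1 N2; have [Vn qn] := hu n.
have {hN1} xn := hN1 n (leq_maxl _ _); have {hN2} en := hN2 n (leq_maxr _ _).
have xnM : `|b (x - u n) v| <= e * (`|M| * rnorm v).
  apply: (le_trans (bM _ _)).
  apply: (@le_trans _ _ (`|M| * (rnorm (x - u n) * rnorm v))).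
    by rewrite ler_wpM2r ?mulr_ge0 ?rnorm_ge0 ?ler_norm.
  by rewrite mulrCA ler_wpM2r ?mulr_ge0 ?rnorm_ge0// ltW.
(* Compare u n with u n + t v for every real t. *)
have first_var : `|b (u n) v - phi v| <= e * Num.sqrt (b v v).
  rewrite -ler_sqr ?nnegrE ?mulr_ge0 ?sqrtr_ge0 ?(ltW e0)//.
  rewrite real_normK ?num_real//.
  rewrite exprMn sqr_sqrtr ?b_ge0//.
  apply: discriminant_le; rewrite ?b_ge0 ?sqr_ge0// => t.
  have := m_le _ (sV.2 t%:C _ _ Vv Vn); rewrite /q !(bl, br, phil) (bC v) => h.
  move: qn; rewrite /q; move: (n.+1%:R^-1) en => d en qn; lra.
have -> : b x v - phi v = b (x - u n) v + (b (u n) v - phi v).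
  have -> : x - u n = (-1 : R)%:C *: u n + x by rewrite rmorphN scaleN1r addrC.
  by rewrite bl; ring.
by rewrite (le_trans (ler_normD _ _))// mulrDr lerD.
Qed.

(** A gliding-hump argument.  If [W] were unbounded, pick [w n] in [W] of norm
above [n * 3 ^+ n], and move from [x n] to [x n.+1] by a vector of length
[3 ^- n] along [w n], with the sign that makes [|<x n.+1, w n>|] at least
[3 ^- n * |w n|].  All later moves add up to at most
half of [3 ^- n], so the limit [y] has [|<y, w n>|] at least [n / 2], against
the bound that [W] satisfies at [y]. *)
Lemma weakly_bounded (V W : set H) : closed V -> is_subspace V -> W `<=` V ->
  (forall y, V y -> exists M, forall w, W w -> `|rdot y w| <= M) ->
  exists C, forall w, W w -> rnorm w <= C.
Proof.
move=> clV sV WV wb; apply: contrapT => unb.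
have /choice[w hw] : forall n : nat, exists w, W w /\ n%:R * 3 ^+ n < rnorm w.
  move=> n; apply: contrapT => h; apply: unb; exists (n%:R * 3 ^+ n) => w Ww.
  by rewrite leNgt; apply/negP => nw; apply: h; exists w.
pose r n : R := 3^-1 ^+ n.
have r_gt0 n : 0 < r n by rewrite exprn_gt0.
have rS n : r n.+1 = r n / 3 by rewrite /r exprSr.
have w_gt0 n : 0 < rnorm (w n).
  by apply: le_lt_trans (hw n).2; rewrite mulr_ge0 ?exprn_ge0.
have /choice[step hstep] : forall nx : nat * H, exists v,
    [/\ V v, rnorm v = r nx.1 &
       r nx.1 * rnorm (w nx.1) <= `|rdot (nx.2 + v) (w nx.1)|].
  move=> [n x] /=.
  pose v := (r n / rnorm (w n))%:C *: w n.
  have Vv : V v by apply: subspaceZ => //; apply: WV; case: (hw n).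
  have nv : rnorm v = r n.
    by rewrite rnormZr ger0_norm ?divr_ge0 ?ltW// divfK ?gt_eqF.
  have dv : rdot v (w n) = r n * rnorm (w n).
    by rewrite rdotZl -(rnorm_sqr hdot) expr2 mulrA divfK ?gt_eqF.
  (* Moving with the sign of <x, w n> cannot cancel it. *)
  have [s|s] := leP 0 (rdot x (w n)).
    exists v; split=> //; rewrite rdotDl dv ger0_norm; first by lra.
    by rewrite addr_ge0 // mulr_ge0 // ltW.
  exists (- v); split; rewrite ?rnormN//.
    by rewrite -sub0r; apply: subspaceB => //; case: sV.
  rewrite rdotBl dv ltr0_norm; last first.
    by have := mulr_gt0 (r_gt0 n) (w_gt0 n); lra.
  lra.
pose fix x n : H := if n is k.+1 then x k + step (k, x k) else 0.
have Vx n : V (x n).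
  elim: n => [|n IH] /=; first by case: sV.
  by apply: subspaceD => //; case: (hstep (n, x n)).
(* The lengths r n telescope: r n = 3 / 2 * (r n - r n.+1). *)
have xdist n k : rnorm (x (n + k)%N - x n) <= 3 / 2 * (r n - r (n + k)%N).
  elim: k => [|k IH]; first by rewrite addn0 !subrr rnorm0 mulr0.
  rewrite addnS /= addrAC (le_trans (ler_rnormD _ _))//.
  have [_ /= -> _] := hstep ((n + k)%N, x (n + k)%N).
  by rewrite rS; lra.
have xdist_lt n k : (n <= k)%N -> rnorm (x k - x n) < 3 / 2 * r n.
  move=> /subnKC <-; apply: (le_lt_trans (xdist _ _)).
  by have := r_gt0 (n + (k - n))%N; lra.
have r_small (e : R) : 0 < e -> exists n, 3 * r n < e.
  move=> e0; pose n := Num.truncn (3 / e); exists n.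
  have h1 : 3 / e < n.+1%:R by exact: truncnS_gt.
  have h2 : n.+1%:R <= 3 ^+ n :> R by rewrite -natrX ler_nat ltn_expl.
  rewrite /r exprVn ltr_pdivrMr ?exprn_gt0// mulrC -ltr_pdivrMr//.
  exact: lt_le_trans h1 h2.
have Cx (e : R) : 0 < e -> exists N, forall i j, (N <= i)%N -> (N <= j)%N ->
    rnorm (x i - x j) < e.
  move=> /r_small[n rn]; exists n => i j ni nj.
  have := xdist_lt _ _ ni; have := xdist_lt _ _ nj.
  have := ler_rnormD (x i - x n) (x n - x j).
  by rewrite addrA subrK (rnorm_distC (x n)); lra.
have [y Vy xy] := cauchy_converges clV Vx Cx.
have ydist n : rnorm (y - x n.+1) <= r n / 2.
  apply/ler_addgt0Pr => e e0; have [N hN] := xy _ e0.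
  have := hN _ (leq_maxl N n.+1); have := xdist_lt _ _ (leq_maxr N n.+1).
  have := ler_rnormD (y - x (maxn N n.+1)) (x (maxn N n.+1) - x n.+1).
  by rewrite addrA subrK rS; lra.
have [M hM] := wb _ Vy.
pose n := (Num.truncn (2 * M)).+1.
have nM : 2 * M < n%:R by exact: truncnS_gt.
have [Wn wn] := hw n; have := hM _ Wn; apply/negP; rewrite -ltNge.
have [_ _ /= big] := hstep (n, x n).
have := rdot_le hdot (y - x n.+1) (w n).
have : rnorm (y - x n.+1) * rnorm (w n) <= r n / 2 * rnorm (w n).
  by rewrite ler_wpM2r ?rnorm_ge0.
have e : rdot (x n + step (n, x n)) (w n) =
    rdot y (w n) - rdot (y - x n.+1) (w n).
  by rewrite rdotBl /=; ring.
rewrite {}e in big.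
have := ler_normB (rdot y (w n)) (rdot (y - x n.+1) (w n)).
have : n%:R <= r n * rnorm (w n).
  by rewrite /r exprVn mulrC ler_pdivlMr ?exprn_gt0// ltW.
lra.
Qed.

End Existence.

(** * Bounded operators *)

Section Operators.
Context (R : realType) (H : completeNormedModType R[i]).

Definition linop (T : H -> H) (lT : linear T) : {linear H -> H} :=
  HB.pack T (GRing.isLinear.Build _ _ _ _ _ lT).

Lemma linop0 (T : H -> H) : linear T -> T 0 = 0.
Proof. by move=> lT; exact: (linear0 (linop lT)). Qed.

Lemma linopB (T : H -> H) x y : linear T -> T (x - y) = T x - T y.
Proof. by move=> lT; exact: (linearB (linop lT)). Qed.

Lemma linopZ (T : H -> H) a x : linear T -> T (a *: x) = a *: T x.
Proof. by move=> lT; exact: (linearZZ (linop lT)). Qed.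

Lemma bounded_operatorP (T : H -> H) : bounded_operator T <->
  linear T /\ exists2 K : R, 0 <= K & forall x, rnorm (T x) <= K * rnorm x.
Proof.
split=> [[lT [M hM]]|[lT [K K0 hK]]]; split=> //; last first.
  by exists K%:C => x; rewrite !rnormE -rmorphM lecR hK.
exists `|complex.Re M| => // x.
have := hM x; rewrite !rnormE lecE => /andP[_ /=] /le_trans; apply.
by case: M {hM} => p q /=; rewrite mulr0 subr0 ler_wpM2r ?rnorm_ge0 ?ler_norm.
Qed.

Lemma bounded_id : bounded_operator (@idfun H).
Proof.
by apply/bounded_operatorP; split=> //; exists 1 => // x; rewrite mul1r.
Qed.

Lemma bounded_comp (S T : H -> H) :
  bounded_operator S -> bounded_operator T -> bounded_operator (S \o T).
Proof.
move=> /bounded_operatorP[lS [K K0 hK]] /bounded_operatorP[lT [L L0 hL]].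
apply/bounded_operatorP; split; first by move=> a x y /=; rewrite lT lS.
exists (K * L); first exact: mulr_ge0.
by move=> x; rewrite -mulrA (le_trans (hK _))// ler_wpM2l.
Qed.

Lemma bounded_add (S T : H -> H) :
  bounded_operator S -> bounded_operator T -> bounded_operator (S + T).
Proof.
move=> /bounded_operatorP[lS [K K0 hK]] /bounded_operatorP[lT [L L0 hL]].
apply/bounded_operatorP; split.
  by move=> a x y; rewrite !fctE lT lS scalerDr addrACA.
exists (K + L); first exact: addr_ge0.
by move=> x; rewrite fctE mulrDl (le_trans (ler_rnormD _ _))// lerD.
Qed.

Lemma bounded_scale (a : R[i]) (T : H -> H) :
  bounded_operator T -> bounded_operator (a *: T).
Proof.
move=> [lT [M hM]]; split.
  by move=> b x y; rewrite !fctE lT scalerDr !scalerA mulrC.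
by exists (`|a| * M) => x; rewrite fctE normrZ -mulrA ler_wpM2l.
Qed.

Lemma bounded_iter n (T : H -> H) :
  bounded_operator T -> bounded_operator (iter n T).
Proof.
move=> bT; elim: n => [|n IH]; first exact: bounded_id.
exact: (bounded_comp bT IH).
Qed.

Lemma bounded_poly_operator (p : {poly R[i]}) (T : H -> H) :
  bounded_operator T -> bounded_operator (poly_operator p T).
Proof.
move=> bT; rewrite /poly_operator; elim/big_ind: _.
- split=> [a x y|]; first by rewrite -[RHS]/(a *: 0 + 0) scaler0 addr0.
  by exists 0 => x; rewrite -[`|_|]/(`|0 : H|) normr0 mul0r.
- exact: bounded_add.
- by move=> i _; apply: bounded_scale; exact: bounded_iter.
Qed.

(** Without constant term, every monomial of [p(T)] ends with a factor [T],
which absorbs [P]. *)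
Lemma poly_operator_fixed (p : {poly R[i]}) (T P : H -> H) :
  p.[0] = 0 -> T \o P = T -> poly_operator p T \o P = poly_operator p T.
Proof.
rewrite horner_coef0 => p0 TP; apply/funext => x.
rewrite /poly_operator /= !fct_sumE; apply: eq_bigr => -[[|i] ilt] _ /=.
  by rewrite p0 !fctE !scale0r.
by rewrite !fctE !iterSr (_ : T (P x) = T x)// -[in RHS]TP.
Qed.

Lemma range_subspace (T : H -> H) : linear T -> is_subspace (range T).
Proof.
move=> lT; split; first by exists 0; rewrite ?linop0.
by move=> a _ _ [x _ <-] [y _ <-]; exists (a *: x + y); rewrite ?lT.
Qed.

Lemma setT_subspace : is_subspace (@setT H).
Proof. by []. Qed.

(** Passes from the real inner product to the complex one: the imaginary part
of [g v] is the real part of [- g ('i *: v)]. *)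
Lemma Re_eq0_on_subspace (V : set H) (g : H -> R[i]) : is_subspace V ->
  (forall a v, g (a *: v) = a * g v) ->
  (forall v, V v -> complex.Re (g v) = 0) -> forall v, V v -> g v = 0.
Proof.
move=> sV gZ g0 v Vv; have := g0 _ Vv; have := g0 _ (subspaceZ 'i sV Vv).
rewrite gZ mulrC ReiNIm => /eqP; rewrite oppr_eq0 => /eqP gi gr.
by rewrite [LHS]complexE gi gr !rmorph0 mulr0 addr0.
Qed.

(** * The adjoint *)

Context (dot : {dot H for Num.conj}) (hdot : induces_norm dot).
Local Notation adjoint := (adjoint dot).
Local Notation rdot := (rdot dot).

Lemma dot_conj_eq x y z t : dot x y = dot z t -> dot y x = dot t z.
Proof. by move=> h; rewrite dotC h -dotC. Qed.

Lemma adjoint_unique (T S S' : H -> H) :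
  (forall x y, dot (T x) y = dot x (S y)) ->
  (forall x y, dot (T x) y = dot x (S' y)) -> S = S'.
Proof.
move=> hS hS'; apply/funext => y; apply: (@dot_inj _ _ dot) => x.
by rewrite -hS -hS'.
Qed.

(** Riesz representation of [x |-> <T x, y>], for each [y]. *)
Lemma exists_adjoint (T : H -> H) : bounded_operator T ->
  exists S, bounded_operator S /\ forall x y, dot (T x) y = dot x (S y).
Proof.
move=> /bounded_operatorP[lT [K K0 hK]].
have /choice[S hS] y : exists z, forall x, dot (T x) y = dot x z.
  have [|||||||||z _ hz] := @symmetric_lax_milgram _ _ setT rdot
      (fun x => rdot (T x) y) 1 1 (K * rnorm y).
  - exact: closedT.
  - exact: setT_subspace.
  - exact: rdotPl.
  - exact: rdotC.
  - exact: ltr01.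
  - by move=> v _; rewrite mul1r (rnorm_sqr hdot).
  - by move=> u v; rewrite mul1r (rdot_le hdot).
  - by move=> a u v; rewrite lT rdotPl.
  - move=> v; rewrite (le_trans (rdot_le hdot _ _))// mulrAC.
    by rewrite ler_wpM2r ?rnorm_ge0.
  exists z => x; apply/eqP; rewrite -subr_eq0; apply/eqP.
  apply: (Re_eq0_on_subspace (g := fun x => dot (T x) y - dot x z)
            setT_subspace) => // [a v|v _].
    by rewrite (linopZ _ _ lT) !linearZl_LR /= mulrBr.
  have hzv := hz v I; rewrite rdotC in hzv.
  by rewrite raddfB /= -/(rdot (T v) y) -/(rdot v z) hzv subrr.
exists S; split=> //; apply/bounded_operatorP; split.
  move=> a x y; apply: (@dot_inj _ _ dot) => z.
  by rewrite linearPr /= -!hS linearPr.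
exists K => // y; have [->|Sy0] := eqVneq (S y) 0.
  by rewrite rnorm0 mulr_ge0 ?rnorm_ge0.
have Sy_gt0 : 0 < rnorm (S y) by rewrite lt_def rnorm_eq0 Sy0 rnorm_ge0.
rewrite -(ler_pM2r Sy_gt0) -expr2 (rnorm_sqr hdot) /rdot -hS.
rewrite (le_trans (ler_norm _))// (le_trans (rdot_le hdot _ _))//.
by rewrite mulrAC ler_wpM2r ?rnorm_ge0.
Qed.

Lemma adjointP (T : H -> H) : bounded_operator T ->
  bounded_operator (adjoint T) /\ forall x y, dot (T x) y = dot x (adjoint T y).
Proof.
move=> /exists_adjoint; exact: (@getPex _ [set S | bounded_operator S /\
  forall x y, dot (T x) y = dot x (S y)]).
Qed.

Lemma adjoint_eq (T S : H -> H) : bounded_operator S ->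
  (forall x y, dot (T x) y = dot x (S y)) -> adjoint T = S.
Proof.
move=> bS hS; have [] : bounded_operator (adjoint T) /\
    forall x y, dot (T x) y = dot x (adjoint T y).
  apply: (@getPex _ [set S | bounded_operator S /\
    forall x y, dot (T x) y = dot x (S y)]).
  by exists S.
by move=> _ /adjoint_unique; exact.
Qed.

Lemma adjointPl (T : H -> H) x y : bounded_operator T ->
  dot (adjoint T x) y = dot x (T y).
Proof. by move=> /adjointP[_ h]; apply: dot_conj_eq; rewrite h. Qed.

(** * The Moore-Penrose inverse *)

(** With [T'] the adjoint of [T], the [w] in [R(T)] with [|T' w| <= 1] satisfy
[|<T x, w>| = |<x, T' w>| <= |x|], so they are weakly bounded in the closed
subspace [R(T)], hence bounded. *)
Lemma adjoint_bounded_below (T : H -> H) :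
  bounded_operator T -> closed (range T) ->
  exists2 C : R, 0 < C &
    forall w, range T w -> rnorm w <= C * rnorm (adjoint T w).
Proof.
move=> bT clT; have [bTs adj] := adjointP bT.
have sV := range_subspace bT.1.
have [||C hC] := @weakly_bounded _ _ _ hdot (range T)
    [set w | range T w /\ rnorm (adjoint T w) <= 1] clT sV.
- by move=> w [].
- move=> _ [x _ <-]; exists (rnorm x) => w [_ w1].
  rewrite /rdot adj -/(rdot _ _) (le_trans (rdot_le hdot _ _))//.
  by rewrite ler_piMr ?rnorm_ge0.
have C0 : 0 <= C.
  rewrite -(@rnorm0 _ H); apply: hC; split; first by case: sV.
  by rewrite (linop0 bTs.1) rnorm0.
(* C may be 0, and then C + 1 is still a positive constant that works.  The
   scaling factor uses s + d because s may be 0 as well. *)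
exists (C + 1); first by lra.
move=> w Vw; set s := rnorm (adjoint T w).
have s0 : 0 <= s by exact: rnorm_ge0.
apply/ler_addgt0Pr => e e0; pose d := e / (C + 1).
have d0 : 0 < d by rewrite divr_gt0//; lra.
have sd0 : 0 < s + d by lra.
have : rnorm ((s + d)^-1%:C *: w) <= C.
  apply: hC; split; first exact: subspaceZ.
  rewrite (linopZ _ _ bTs.1) rnormZr gtr0_norm ?invr_gt0// mulrC.
  by rewrite ler_pdivrMr// mul1r; lra.
rewrite rnormZr gtr0_norm ?invr_gt0// mulrC ler_pdivrMr// => h.
have dE : d * (C + 1) = e by rewrite divfK// gt_eqF//; lra.
nra.
Qed.

(** With [T'] the adjoint of [T], the vector [S y] is the only [u] in [R(T')]
such that [T u] is the orthogonal projection of [y] on [R(T)].  Linearity and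
[S T S = S] follow from this uniqueness; [T S] and [S T] are self-adjoint as
the orthogonal projections on [R(T)] and [R(T')]. *)
Lemma exists_moore_penrose (T : H -> H) :
  bounded_operator T -> closed (range T) ->
  exists S, bounded_operator S /\
    [/\ T \o S \o T = T, S \o T \o S = S,
        adjoint (S \o T) = S \o T & adjoint (T \o S) = T \o S].
Proof.
move=> bT clT; have [bTs adj] := adjointP bT.
have lT := bT.1; have lTs := bTs.1.
have [C C0 hC] := adjoint_bounded_below bT clT.
have [_ [K K0 hK]] := (bounded_operatorP _).1 bTs.
have sV := range_subspace lT.
have /choice[w hw] y : exists w, range T w /\
    forall v, range T v -> dot (adjoint T v) (adjoint T w) = dot v y.
  have [|||||||||w Vw hw] := @symmetric_lax_milgram _ _ (range T)
      (fun u v => rdot (adjoint T u) (adjoint T v))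
      (fun v => rdot v y) (C ^- 2) (K ^+ 2) (rnorm y).
  - exact: clT.
  - exact: sV.
  - by move=> a u v z; rewrite lTs rdotPl.
  - by move=> u v; exact: rdotC.
  - by rewrite invr_gt0 exprn_gt0.
  - move=> v Vv; rewrite -(rnorm_sqr hdot) mulrC ler_pdivrMr ?exprn_gt0//.
    rewrite mulrC -exprMn ler_sqr ?nnegrE ?rnorm_ge0 ?hC//.
    by rewrite mulr_ge0 ?rnorm_ge0// ltW.
  - move=> u v; rewrite (le_trans (rdot_le hdot _ _))// expr2 mulrACA.
    by rewrite ler_pM ?rnorm_ge0.
  - by move=> a u v; rewrite rdotPl.
  - by move=> v; rewrite (le_trans (rdot_le hdot _ _))// mulrC.
  exists w; split=> // v Vv; apply/eqP; rewrite -subr_eq0; apply/eqP.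
  apply: (Re_eq0_on_subspace
    (g := fun v => dot (adjoint T v) (adjoint T w) - dot v y) sV) => //.
    by move=> a u; rewrite (linopZ _ _ lTs) !linearZl_LR /= mulrBr.
  move=> u Vu; rewrite raddfB /= -/(rdot u y).
  have /= hwu := hw u Vu; rewrite rdotC in hwu.
  by rewrite -/(rdot (adjoint T u) (adjoint T w)) hwu subrr.
pose S y := adjoint T (w y).
(* T (S y) is the orthogonal projection of y on the range of T. *)
have TS y x : dot (T x) (T (S y)) = dot (T x) y.
  by rewrite -adjointPl// (hw y).2//; exists x.
have S_unique y z : (forall x, dot (T x) (T (adjoint T z)) = dot (T x) y) ->
    adjoint T z = S y.
  move=> h; apply/eqP; rewrite -subr_eq0; apply/eqP.
  have Td : T (adjoint T z - S y) = 0.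
    by apply: (@dotxx_eq0 _ _ dot); rewrite {2}linopB// linearBr /= h TS subrr.
  apply: (@dotxx_eq0 _ _ dot).
  by rewrite [X in dot _ X](esym (linopB _ _ lTs)) -adj Td linear0l.
have SE u : S (T (adjoint T u)) = adjoint T u.
  by apply/esym/S_unique.
have bS : bounded_operator S.
  apply/bounded_operatorP; split.
    move=> a x y; apply/esym; rewrite /S -lTs; apply: S_unique => t.
    by rewrite lTs lT !linearPr /= !TS.
  exists C => [|y]; first exact: ltW.
  have [Vw hwy] := hw y; have [->|Sy0] := eqVneq (S y) 0.
    by rewrite rnorm0 mulr_ge0 ?rnorm_ge0 ?ltW.
  have Sy_gt0 : 0 < rnorm (S y) by rewrite lt_def rnorm_eq0 Sy0 rnorm_ge0.
  rewrite -(ler_pM2r Sy_gt0) -expr2 (rnorm_sqr hdot) /rdot hwy//.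
  rewrite (le_trans (ler_norm _))// (le_trans (rdot_le hdot _ _))//.
  by rewrite mulrAC ler_wpM2r ?rnorm_ge0// hC.
have TST x : T (S (T x)) = T x.
  apply/eqP; rewrite -subr_eq0; apply/eqP; apply: (@dotxx_eq0 _ _ dot).
  by rewrite -{1}linopB// linearBr /= TS subrr.
exists S; split=> //; split.
- by apply/funext => x; rewrite /= TST.
- by apply/funext => y; rewrite /= {2}/S SE.
- apply: adjoint_eq; first exact: bounded_comp.
  have STl x y : dot (S (T x)) y = dot (S (T x)) (S (T y)).
    apply/eqP; rewrite -subr_eq0 -linearBr /= {1}/S adjointPl//.
    by rewrite linopB// TST subrr linear0r.
  by move=> x y /=; rewrite STl; apply/esym/dot_conj_eq; rewrite STl.
- apply: adjoint_eq; first exact: bounded_comp.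
  by move=> x y /=; rewrite -TS; apply/esym/dot_conj_eq; rewrite TS.
Qed.

End Operators.

Lemma moore_penroseP (R : realType) (H : completeNormedModType R[i])
    (dot : {dot H for Num.conj}) (T : H -> H) :
  induces_norm dot -> bounded_operator T -> closed (range T) ->
  let S := moore_penrose dot T in
  bounded_operator S /\
    [/\ T \o S \o T = T, S \o T \o S = S,
        adjoint dot (S \o T) = S \o T & adjoint dot (T \o S) = T \o S].
Proof.
move=> hdot bT clT; apply: (@getPex _ [set S : H -> H | bounded_operator S /\
  [/\ T \o S \o T = T, S \o T \o S = S,
      adjoint dot (S \o T) = S \o T & adjoint dot (T \o S) = T \o S]]).
exact: exists_moore_penrose hdot _ bT clT.
Qed.

(** With [P = Td \o T], and a prime for adjoints, [P] is the orthogonal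
projection on [R(T')]: it fixes [T' x] because [P T' = (T P)' = T'], and its
values lie in [R(T')] because [P = P' = T' Td']. *)
Lemma moore_penrose_adjoint_range (R : realType)
    (H : completeNormedModType R[i]) (dot : {dot H for Num.conj}) (T : H -> H)
    (hdot : induces_norm dot) (bT : bounded_operator T)
    (clT : closed (range T)) (y : H) :
  range (adjoint dot T) y <-> moore_penrose dot T (T y) = y.
Proof.
have [bS [TST _ adjP _]] := moore_penroseP hdot bT clT.
set S := moore_penrose dot T in bS TST adjP *.
have bP : bounded_operator (S \o T) := bounded_comp bS bT.
have adjPE x z : dot (S (T x)) z = dot x (S (T z)).
  by have [_ h] := adjointP hdot bP; have := h x z; rewrite adjP.
split=> [[x _ <-]|<-].
  apply: (@dot_inj _ _ dot) => z; rewrite -adjPE -!(adjointP hdot bT).2.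
  by congr (dot _ x); exact: (congr1 (@^~ z) TST).
exists (adjoint dot S y) => //; apply: (@dot_inj _ _ dot) => z.
by rewrite -(adjointP hdot bT).2 -(adjointP hdot bS).2 adjPE.
Qed.

(** * The equivalence *)

Theorem theorem2 (R : realType) (H : completeNormedModType R[i])
    (dot : {dot H for Num.conj}) (hdot : induces_norm dot)
    (T : H -> H) (hT : bounded_operator T) (hcl : closed (range T))
    (p : {poly R[i]}) (hp : p.[0] = 0) :
  let Td := moore_penrose dot T in
  let pT := poly_operator p T in
  [<-> hypo_EP dot p T;
       pT = Td \o T \o pT;
       range pT `<=` range (adjoint dot T);
       Td \o T \o pT \o Td = pT \o Td;
       (Td \o T \o pT) + adjoint dot (Td \o T \o pT) = pT + adjoint dot pT].
Proof.
move=> Td pT.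
have [bTd [TTdT _ _ _]] := moore_penroseP hdot hT hcl; rewrite -/Td in bTd TTdT.
have bpT : bounded_operator pT by exact: bounded_poly_operator.
have pTP : pT \o (Td \o T) = pT by exact: poly_operator_fixed.
have bPpT : bounded_operator (Td \o T \o pT).
  exact: bounded_comp (bounded_comp bTd hT) bpT.
tfae.
- by move=> [_ h]; exact: etrans (esym pTP) (esym h).
- move=> h _ [x _ <-]; apply/(moore_penrose_adjoint_range hdot hT hcl).
  by rewrite -/Td [in RHS]h.
- move=> h; suff -> : Td \o T \o pT = pT by [].
  apply/funext => x; apply/(moore_penrose_adjoint_range hdot hT hcl)/h.
  by exists x.
- move=> h; suff -> : Td \o T \o pT = pT by [].
  by rewrite -[in LHS]pTP -[RHS]pTP; exact: (congr1 (fun F => F \o T) h).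
- move=> h; split=> //; rewrite -/Td -/pT.
  rewrite -[pT \o Td \o T]/(pT \o (Td \o T)) pTP.
  pose D x := pT x - Td (T (pT x)).
  have skew x y : dot (D x) y + dot x (D y) = 0.
    have e : dot (Td (T (pT x))) y + dot x (Td (T (pT y))) =
             dot (pT x) y + dot x (pT y).
      have := congr1 (fun F => dot (F x) y) h.
      by rewrite !fctE !linearDl /= !adjointPl.
    rewrite /D linearBl linearBr /=.
    by rewrite addrACA -e -opprD subrr.
  have DD x : D (D x) = 0.
    have pTD : pT (D x) = 0.
      have TD : T (D x) = 0.
        rewrite /D linopB; last exact: hT.1.
        by rewrite (_ : T (Td _) = T (pT x)) ?subrr// -[in RHS]TTdT.
      by rewrite -pTP /= TD (linop0 bTd.1) (linop0 bpT.1).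
    by rewrite {1}/D pTD (linop0 hT.1) (linop0 bTd.1) subrr.
  apply/funext => x /=; apply/esym/eqP; rewrite -subr_eq0; apply/eqP.
  apply: (@dotxx_eq0 _ _ dot); rewrite -/(D x).
  by have := skew x (D x); rewrite DD linear0r addr0.
Qed.
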